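(* Let $\{z^t\}_{t\ge 0}$ be a sequence generated by QRTC (as defined in the context). Then there exists a constant $K_1>0$ such that, for all $t\ge0$, $$f(z^t)-f(z^{t+1})\ \ge\ K_1\|z^t-z^{t+1}\|_2^2 .$$ Moreover, the sequence $\{z^t\}$ is bounded.
   Context: $\mathbb{H}$ is the real quaternion algebra with units $\mathbf{i},\mathbf{j},\mathbf{k}$; for a quaternion matrix, $A^*$ is the conjugate transpose; $\|\cdot\|_F$ is the Frobenius norm of quaternion matrices/tensors; $\Re$ is the entrywise real part. Fix a unit pure quaternion $\mu$ ($\mu^2=-1$). $F_{\mu,n}\in\mathbb{H}^{n\times n}$ has entries $\frac1{\sqrt n}\left(\cos\frac{2\pi(p-1)(q-1)}{n}-\mu\sin\frac{2\pi(p-1)(q-1)}{n}\right)$. The QDFT $\hat{\mathcal{X}}$ of $\mathcal{X}\in\mathbb{H}^{n_1\times n_2\times n_3}$ is the tensor with $\hat{\mathcal{X}}(i,j,:)=\sqrt{n_3}\,F_{\mu,n_3}\mathcal{X}(i,j,:)$ (an invertible map), and $\hat{\mathcal{X}}^{(l)}=\hat{\mathcal{X}}(:,:,l)$. Data: $\mathcal{M}\in\mathbb{H}^{n_1\times n_2\times n_3}$ with $\Re(\mathcal{M})=0$; $\Omega\subseteq\{1,\dots,n_1\}\times\{1,\dots,n_2\}\times\{1,\dots,n_3\}$ with complement $\Omega^c$; $P_\Omega$ (resp. $P_{\Omega^c}$) keeps the entries indexed by $\Omega$ (resp. $\Omega^c$) and sets the others to zero; positive integers $\mathbf{r}=(r_1,\dots,r_{n_3})$;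 parameters $\lambda,\lambda_1,\lambda_2,\beta>0$. Variables: $\mathcal{C}=\mathcal{C}_{\mathbf i}\mathbf{i}+\mathcal{C}_{\mathbf j}\mathbf{j}+\mathcal{C}_{\mathbf k}\mathbf{k}$ with real tensors $\mathcal{C}_\alpha\in\mathbb{R}^{n_1\times n_2\times n_3}$; $\hat{\mathcal{A}}=(\hat{\mathcal{A}}^{(l)})_{l=1}^{n_3}$ with $\hat{\mathcal{A}}^{(l)}\in\mathbb{H}^{n_1\times r_l}$; $\hat{\mathcal{B}}=(\hat{\mathcal{B}}^{(l)})_{l=1}^{n_3}$ with $\hat{\mathcal{B}}^{(l)}\in\mathbb{H}^{r_l\times n_2}$; $\|\hat{\mathcal{A}}\|_F^2=\sum_l\|\hat{\mathcal{A}}^{(l)}\|_F^2$, likewise for $\hat{\mathcal{B}}$. $\mathcal{A}*_\mu\mathcal{B}\in\mathbb{H}^{n_1\times n_2\times n_3}$ denotes the tensor whose QDFT has $l$-th frontal slice $\hat{\mathcal{A}}^{(l)}\hat{\mathcal{B}}^{(l)}$. All real components of $\mathcal{C},\hat{\mathcal{A}},\hat{\mathcal{B}}$ are collected in a real vector $z\in\mathbb{R}^{3n_1n_2n_3+4\|\mathbf{r}\|_1(n_1+n_2)}$. Let $\mathrm{TV}(\mathcal{C})=\lambda_1\sum_{k=1}^{n_1-1}\|\mathcal{C}(k,:,:)-\mathcal{C}(k+1,:,:)\|_F^2+\lambda_2\sum_{k=1}^{n_2-1}\|\mathcal{C}(:,k,:)-\mathcal{C}(:,k+1,:)\|_F^2$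 and $$f(z)=\tfrac12\|\mathcal{A}*_\mu\mathcal{B}-\mathcal{C}\|_F^2+\tfrac{\lambda}{2n_3}\big(\|\hat{\mathcal{A}}\|_F^2+\|\hat{\mathcal{B}}\|_F^2\big)+\mathrm{TV}(\mathcal{C}).$$ The feasible set is $\Lambda=\{z: P_\Omega(\mathcal{C}-\mathcal{M})=0\}$, and the problem is $\min_{z\in\Lambda}f(z)$. QRTC sequence: $z^0=(\mathcal{C}^0,\hat{\mathcal{A}}^0,\hat{\mathcal{B}}^0)\in\Lambda$ is arbitrary, and for $t=1,2,\dots$ (no stopping), $z^t=(\mathcal{C}^t,\hat{\mathcal{A}}^t,\hat{\mathcal{B}}^t)$ where: (1) $\mathcal{C}^t$ is the minimizer, over $\mathcal{C}$ with $\Re(\mathcal{C})=0$ and $P_\Omega(\mathcal{C}-\mathcal{M})=0$, of $\frac12\|\mathcal{A}^{t-1}*_\mu\mathcal{B}^{t-1}-\mathcal{C}\|_F^2+\mathrm{TV}(\mathcal{C})+\sum_{\alpha\in\{\mathbf i,\mathbf j,\mathbf k\}}\langle\delta^t_\alpha,\mathcal{C}_\alpha\rangle$, for some error tensor $\delta^t=\delta^t_{\mathbf i}\mathbf{i}+\delta^t_{\mathbf j}\mathbf{j}+\delta^t_{\mathbf k}\mathbf{k}$ (so $\Re(\delta^t)=0$) with $P_\Omega(\delta^t)=0$ and $\|P_{\Omega^c}(\delta^t)\|_F\le\frac14\|\mathcal{C}^t-\mathcal{C}^{t-1}\|_F$; (2) for each $l$, $\hat{\mathcal{A}}^{t,(l)}=\big(\hat{\mathcal{C}}^{t,(l)}(\hat{\mathcal{B}}^{t-1,(l)})^*+\beta\hat{\mathcal{A}}^{t-1,(l)}\big)\big(\hat{\mathcal{B}}^{t-1,(l)}(\hat{\mathcal{B}}^{t-1,(l)})^*+(\lambda+\beta)I\big)^{-1}$;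 (3) for each $l$, $\hat{\mathcal{B}}^{t,(l)}=\big((\hat{\mathcal{A}}^{t,(l)})^*\hat{\mathcal{A}}^{t,(l)}+(\lambda+\beta)I\big)^{-1}\big((\hat{\mathcal{A}}^{t,(l)})^*\hat{\mathcal{C}}^{t,(l)}+\beta\hat{\mathcal{B}}^{t-1,(l)}\big)$. *)

(* Defs.v *)
From HB Require Import structures.
From mathcomp Require Import all_boot all_order all_algebra.
From mathcomp Require Import ring.
From mathcomp Require Import boolp classical_sets reals trigo.

Set Implicit Arguments.
Unset Strict Implicit.
Unset Printing Implicit Defensive.

Import Order.TTheory GRing.Theory Num.Theory.
Local Open Scope ring_scope.

(* [Quat a b c d] is the quaternion a + b i + c j + d k. *)
Record quat (R : Type) := Quat { qre : R; qi : R; qj : R; qk : R }.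

Definition quat_tuple (R : Type) (x : quat R) := (qre x, qi x, qj x, qk x).
Definition tuple_quat (R : Type) (x : R * R * R * R) :=
  let: (a, b, c, d) := x in Quat a b c d.
Lemma quat_tupleK (R : Type) : cancel (@quat_tuple R) (@tuple_quat R).
Proof. by case. Qed.

HB.instance Definition _ (R : choiceType) :=
  Choice.copy (quat R) (can_type (@quat_tupleK R)).

Section QuaternionRing.
Context {R : comNzRingType}.
Implicit Types x y z : quat R.

Definition addH x y :=
  Quat (qre x + qre y) (qi x + qi y) (qj x + qj y) (qk x + qk y).
Definition oppH x := Quat (- qre x) (- qi x) (- qj x) (- qk x).
Definition mulH x y :=
  Quat (qre x * qre y - qi x * qi y - qj x * qj y - qk x * qk y)
       (qre x * qi y + qi x * qre y + qj x * qk y - qk x * qj y)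
       (qre x * qj y - qi x * qk y + qj x * qre y + qk x * qi y)
       (qre x * qk y + qi x * qj y - qj x * qi y + qk x * qre y).
Definition qreal (a : R) := Quat a 0 0 0.

Lemma addHA : associative addH.
Proof. by move=> [? ? ? ?] [? ? ? ?] [? ? ? ?]; rewrite /addH /= !addrA. Qed.
Lemma addHC : commutative addH.
Proof. by move=> [? ? ? ?] [? ? ? ?]; congr Quat; rewrite /= addrC. Qed.
Lemma add0H : left_id (qreal 0) addH.
Proof. by move=> [? ? ? ?]; rewrite /addH /= !add0r. Qed.
Lemma addNH : left_inverse (qreal 0) oppH addH.
Proof. by move=> [? ? ? ?]; rewrite /addH /= !addNr. Qed.

HB.instance Definition _ :=
  GRing.isZmodule.Build (quat R) addHA addHC add0H addNH.

Lemma mulHA : associative mulH.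
Proof.
by move=> [? ? ? ?] [? ? ? ?] [? ? ? ?]; rewrite /mulH /=; congr Quat; ring.
Qed.
Lemma mul1H : left_id (qreal 1) mulH.
Proof. by move=> [? ? ? ?]; rewrite /mulH /=; congr Quat; ring. Qed.
Lemma mulH1 : right_id (qreal 1) mulH.
Proof. by move=> [? ? ? ?]; rewrite /mulH /=; congr Quat; ring. Qed.
Lemma mulHDl : left_distributive mulH addH.
Proof.
move=> [? ? ? ?] [? ? ? ?] [? ? ? ?].
by rewrite /mulH /addH /=; congr Quat; ring.
Qed.
Lemma mulHDr : right_distributive mulH addH.
Proof.
move=> [? ? ? ?] [? ? ? ?] [? ? ? ?].
by rewrite /mulH /addH /=; congr Quat; ring.
Qed.
Lemma oneH_neq0 : qreal 1 != 0 :> quat R.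
Proof. by apply/eqP => -[] /eqP; rewrite oner_eq0. Qed.

HB.instance Definition _ := GRing.Zmodule_isNzRing.Build (quat R)
  mulHA mul1H mulH1 mulHDl mulHDr oneH_neq0.

Definition qconj x := Quat (qre x) (- qi x) (- qj x) (- qk x).
Definition qnormsq x := qre x ^+ 2 + qi x ^+ 2 + qj x ^+ 2 + qk x ^+ 2.

End QuaternionRing.

Definition ctrmx (R : comNzRingType) (m n : nat) (A : 'M[quat R]_(m, n)) :
  'M[quat R]_(n, m) := map_mx qconj A^T.

(* [invmx] is unavailable over a noncommutative ring; the value is 0 when [G]
   has no two-sided inverse. *)
Definition qinvmx (R : comNzRingType) (n : nat) (G : 'M[quat R]_n) :
    'M[quat R]_n :=
  xget 0 (fun W : 'M[quat R]_n => G *m W = 1%:M /\ W *m G = 1%:M).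

Definition mfrob (R : rcfType) (m n : nat) (A : 'M[quat R]_(m, n)) : R :=
  Num.sqrt (\sum_i \sum_j qnormsq (A i j)).

(* Frobenius norm of a family of matrices of possibly different sizes. *)
Definition ffrob (R : rcfType) (n3 : nat) (m n : 'I_n3 -> nat)
    (A : forall l, 'M[quat R]_(m l, n l)) : R :=
  Num.sqrt (\sum_l mfrob (A l) ^+ 2).

(* A third-order tensor is stored by frontal slices: the entry (i, j, l) of
   [X] is [X l i j]. *)
Definition tensor (T : Type) (n1 n2 n3 : nat) := {ffun 'I_n3 -> 'M[T]_(n1, n2)}.

Section Tensors.
Context {R : realType} {n1 n2 n3 : nat}.
Local Notation qtensor := (tensor (quat R) n1 n2 n3).
Implicit Types X Y : qtensor.

Definition tfrob X : R := ffrob (fun l => X l).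

Definition tpart (T U : Type) (p : T -> U) (X : tensor T n1 n2 n3) :
  tensor U n1 n2 n3 := [ffun l => map_mx p (X l)].

Definition tinner (X Y : tensor R n1 n2 n3) : R :=
  \sum_l \sum_i \sum_j X l i j * Y l i j.

Definition tproj (Omega : {set 'I_n1 * 'I_n2 * 'I_n3}) X : qtensor :=
  [ffun l => \matrix_(i, j) if (i, j, l) \in Omega then X l i j else 0].

Definition hslice X (i : 'I_n1) : 'M[quat R]_(n2, n3) :=
  \matrix_(j, l) X l i j.
Definition vslice X (j : 'I_n2) : 'M[quat R]_(n1, n3) :=
  \matrix_(i, l) X l i j.
Definition tube X (i : 'I_n1) (j : 'I_n2) : 'cV[quat R]_n3 :=
  \col_l X l i j.

(* The sums range over the pairs of consecutive indices (k, k + 1). *)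
Definition TV (lambda1 lambda2 : R) X : R :=
  lambda1 * \sum_(k : 'I_n1 * 'I_n1 | k.2 == k.1.+1 :> nat)
              mfrob (hslice X k.1 - hslice X k.2) ^+ 2
  + lambda2 * \sum_(k : 'I_n2 * 'I_n2 | k.2 == k.1.+1 :> nat)
              mfrob (vslice X k.1 - vslice X k.2) ^+ 2.

End Tensors.

Definition unit_pure (R : realType) (mu : quat R) : Prop :=
  qre mu = 0 /\ Num.sqrt (qnormsq mu) = 1.

(* Indices start at 0, so the shifts p - 1, q - 1 disappear. *)
Definition qdft_mx (R : realType) (mu : quat R) (n : nat) : 'M[quat R]_n :=
  \matrix_(p, q)
    (qreal (Num.sqrt n%:R)^-1 *
       (qreal (cos (2 * pi * p%:R * q%:R / n%:R))
        - mu * qreal (sin (2 * pi * p%:R * q%:R / n%:R)))).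

Definition qdft (R : realType) (mu : quat R) (n1 n2 n3 : nat)
    (X : tensor (quat R) n1 n2 n3) : tensor (quat R) n1 n2 n3 :=
  [ffun l => \matrix_(i, j)
     (qreal (Num.sqrt n3%:R) *: (qdft_mx mu n3 *m tube X i j)) l 0].

(* For n3 > 0 and a unit pure [mu] the QDFT is a bijection, so the preimage
   below exists and is unique. *)
Definition qprod (R : realType) (mu : quat R) (n1 n2 n3 : nat)
    (r : 'I_n3 -> nat) (A : forall l, 'M[quat R]_(n1, r l))
    (B : forall l, 'M[quat R]_(r l, n2)) : tensor (quat R) n1 n2 n3 :=
  xget 0 (fun X : tensor (quat R) n1 n2 n3 =>
            forall l, qdft mu X l = A l *m B l).

(* The real coordinates of (C, A, B): three for each entry of C, four for each
   entry of the factors. *)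
Definition zcoord (n1 n2 n3 : nat) (r : 'I_n3 -> nat) : finType :=
  ('I_n1 * 'I_n2 * 'I_n3 * 'I_3 +
   ({l : 'I_n3 & ('I_n1 * 'I_(r l) * 'I_4)%type} +
    {l : 'I_n3 & ('I_(r l) * 'I_n2 * 'I_4)%type}))%type.

Lemma card_zcoord (n1 n2 n3 : nat) (r : 'I_n3 -> nat) :
  #|zcoord n1 n2 r| = (3 * n1 * n2 * n3 + 4 * (\sum_l r l) * (n1 + n2))%N.
Proof.
rewrite !card_sum !card_tagged !sumnE !big_map -!enumT !big_enum /=.
rewrite !card_prod !card_ord -[RHS]/(_ + _)%N; congr addn; first by ring.
rewrite -big_split big_distrr big_distrl /=; apply: eq_bigr => l _.
by rewrite !card_prod !card_ord; ring.
Qed.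

Section Problem.
Context {R : realType} {n1 n2 n3 : nat} {r : 'I_n3 -> nat}.
Local Notation qtensor := (tensor (quat R) n1 n2 n3).
Local Notation vars := {ffun zcoord n1 n2 r -> R}.
Implicit Types z : vars.

Definition Cof z : qtensor :=
  [ffun l => \matrix_(i, j)
     Quat 0 (z (inl (i, j, l, 0))) (z (inl (i, j, l, 1)))
            (z (inl (i, j, l, 2)))].

Definition Aof z (l : 'I_n3) : 'M[quat R]_(n1, r l) :=
  \matrix_(i, p)
    let x (c : 'I_4) : R :=
      z (inr (inl (Tagged (fun l => 'I_n1 * 'I_(r l) * 'I_4)%type (i, p, c)))) in
    Quat (x 0) (x 1) (x 2) (x 3).

Definition Bof z (l : 'I_n3) : 'M[quat R]_(r l, n2) :=
  \matrix_(p, j)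
    let x (c : 'I_4) : R :=
      z (inr (inr (Tagged (fun l => 'I_(r l) * 'I_n2 * 'I_4)%type (p, j, c)))) in
    Quat (x 0) (x 1) (x 2) (x 3).

Definition norm2 z : R := Num.sqrt (\sum_a z a ^+ 2).

Definition objective (mu : quat R) (lambda lambda1 lambda2 : R) z : R :=
  2^-1 * tfrob (qprod mu (Aof z) (Bof z) - Cof z) ^+ 2
  + lambda / (2 * n3%:R) * (ffrob (Aof z) ^+ 2 + ffrob (Bof z) ^+ 2)
  + TV lambda1 lambda2 (Cof z).

Definition feasible (M : qtensor) (Omega : {set 'I_n1 * 'I_n2 * 'I_n3}) z :=
  tproj Omega (Cof z - M) = 0.

Definition C_objective (mu : quat R) (lambda1 lambda2 : R) z
    (delta C : qtensor) : R :=
  2^-1 * tfrob (qprod mu (Aof z) (Bof z) - C) ^+ 2 + TV lambda1 lambda2 C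
  + (tinner (tpart (@qi R) delta) (tpart (@qi R) C)
     + tinner (tpart (@qj R) delta) (tpart (@qj R) C)
     + tinner (tpart (@qk R) delta) (tpart (@qk R) C)).

Definition C_feasible (M : qtensor) (Omega : {set 'I_n1 * 'I_n2 * 'I_n3})
    (C : qtensor) : Prop :=
  tpart (@qre R) C = 0 /\ tproj Omega (C - M) = 0.

Definition C_step (mu : quat R) (M : qtensor)
    (Omega : {set 'I_n1 * 'I_n2 * 'I_n3}) (lambda1 lambda2 : R)
    (z z' : vars) : Prop :=
  exists delta : qtensor,
    [/\ tpart (@qre R) delta = 0,
        tproj Omega delta = 0,
        tfrob (tproj (~: Omega) delta) <= 4^-1 * tfrob (Cof z' - Cof z),
        C_feasible M Omega (Cof z')
      & forall C, C_feasible M Omega C ->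
          C_objective mu lambda1 lambda2 z delta (Cof z')
          <= C_objective mu lambda1 lambda2 z delta C].

Definition A_step (mu : quat R) (lambda beta : R) (z z' : vars) : Prop :=
  forall l, Aof z' l =
    (qdft mu (Cof z') l *m ctrmx (Bof z l) + qreal beta *: Aof z l)
    *m qinvmx (Bof z l *m ctrmx (Bof z l) + (qreal (lambda + beta))%:M).

Definition B_step (mu : quat R) (lambda beta : R) (z z' : vars) : Prop :=
  forall l, Bof z' l =
    qinvmx (ctrmx (Aof z' l) *m Aof z' l + (qreal (lambda + beta))%:M)
    *m (ctrmx (Aof z' l) *m qdft mu (Cof z') l + qreal beta *: Bof z l).

Definition QRTC (mu : quat R) (M : qtensor)
    (Omega : {set 'I_n1 * 'I_n2 * 'I_n3}) (lambda lambda1 lambda2 beta : R)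
    (z : nat -> vars) : Prop :=
  feasible M Omega (z 0%N) /\
  forall t, [/\ C_step mu M Omega lambda1 lambda2 (z t) (z t.+1),
                A_step mu lambda beta (z t) (z t.+1)
              & B_step mu lambda beta (z t) (z t.+1)].

End Problem.

(* Main.v *)
From HB Require Import structures.
Require Import Defs.
From mathcomp Require Import all_boot all_order all_algebra.
From mathcomp Require Import ring lra.
From mathcomp Require Import classical_sets reals trigo.

(** Each of the three block updates decreases the objective by at least a fixed
    multiple of the squared length of the block's own step, and the three
    decreases add up.

    For the factors, the transform is the right place to look. It is [sqrt n3]
    times a unitary matrix ([qdft_mx_unitary], orthogonality of the roots of
    unity in the field generated by [mu]), so the data term is, up to the factor
    [1 / (2 n3)], the sum over the slices [l] of [|A_l B_l - C_l|^2], where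
    [C_l] is a slice of the transform ([qprod_parseval]). Each factor update
    solves the normal equation of a regularized least-squares problem; expanding
    the square around the solution gives a decrease of at least
    [2 beta + lambda] times the squared step ([ridge_left_decrease],
    [ridge_right_decrease]). The formula defining the update is meaningful
    because a regularized Gram matrix is injective, hence invertible
    ([mulmx_inj_inverse]).

    For the completed tensor, the data term makes the perturbed subproblem
    strongly convex, and the error is too small to cancel the resulting gain
    ([perturbed_min_decrease]).

    Boundedness follows because the objective then never exceeds its initial
    value and is coercive ([norm2_sq_le]). *)

Set Implicit Arguments.
Unset Strict Implicit.
Unset Printing Implicit Defensive.

Import Order.TTheory GRing.Theory Num.Theory.
Local Open Scope ring_scope.

(** * Quaternions *)

Section QuaternionTheory.
Context {R : comNzRingType}.
Implicit Types x y : quat R.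

Lemma quat_ext x y :
  qre x = qre y -> qi x = qi y -> qj x = qj y -> qk x = qk y -> x = y.
Proof. by case: x y => [? ? ? ?] [? ? ? ?] /= -> -> -> ->. Qed.

Lemma qre_is_zmod : zmod_morphism (@qre R). Proof. by []. Qed.
HB.instance Definition _ :=
  GRing.isZmodMorphism.Build (quat R) R (@qre R) qre_is_zmod.

Lemma qconj_is_zmod : zmod_morphism (@qconj R).
Proof. by move=> x y; apply: quat_ext => //=; rewrite opprD. Qed.
HB.instance Definition _ :=
  GRing.isZmodMorphism.Build (quat R) (quat R) (@qconj R) qconj_is_zmod.

Lemma qreal_is_zmod : zmod_morphism (@qreal R).
Proof. by move=> a b; apply: quat_ext => //=; rewrite subr0. Qed.
HB.instance Definition _ :=
  GRing.isZmodMorphism.Build R (quat R) (@qreal R) qreal_is_zmod.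

Lemma qreal_is_monoid : monoid_morphism (@qreal R).
Proof. by split=> // a b; apply: quat_ext => /=; ring. Qed.
HB.instance Definition _ :=
  GRing.isMonoidMorphism.Build R (quat R) (@qreal R) qreal_is_monoid.

Lemma qrealC a x : qreal a * x = x * qreal a.
Proof. by apply: quat_ext => /=; ring. Qed.

Lemma qre_qrealM a x : qre (qreal a * x) = a * qre x.
Proof. by rewrite /=; ring. Qed.

(** The noncommutativity of the product is invisible to the real part; this is
    what makes the real part of a quaternionic trace cyclic. *)
Lemma qre_mulC x y : qre (x * y) = qre (y * x).
Proof. by rewrite /=; ring. Qed.

Lemma qconjM x y : qconj (x * y) = qconj y * qconj x.
Proof. by apply: quat_ext => /=; ring. Qed.

Lemma qconjK : involutive (@qconj R).
Proof. by move=> x; apply: quat_ext => /=; rewrite ?opprK. Qed.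

Lemma qnormsqE x : qnormsq x = qre (x * qconj x).
Proof. by rewrite /qnormsq /=; ring. Qed.

Lemma qnormsqM x y : qnormsq (x * y) = qnormsq x * qnormsq y.
Proof. by rewrite /qnormsq /=; ring. Qed.

Lemma qnormsq_qreal (a : R) : qnormsq (qreal a) = a ^+ 2.
Proof. by rewrite /qnormsq /=; ring. Qed.

Lemma qnormsq0 : qnormsq (0 : quat R) = 0.
Proof. by rewrite (qnormsq_qreal 0) expr0n. Qed.

Lemma qnormsqD x y :
  qnormsq (x + y) = qnormsq x + 2 * qre (x * qconj y) + qnormsq y.
Proof. by rewrite /qnormsq /=; ring. Qed.

Lemma qnormsq_conj x : qnormsq (qconj x) = qnormsq x.
Proof. by rewrite /qnormsq /=; ring. Qed.

End QuaternionTheory.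

Section QuaternionNorm.
Context {R : realDomainType}.
Implicit Types x y : quat R.

Lemma qnormsq_ge0 x : 0 <= qnormsq x.
Proof. by rewrite /qnormsq !addr_ge0 ?sqr_ge0. Qed.

Lemma qnormsq_eq0 x : (qnormsq x == 0) = (x == 0).
Proof.
apply/eqP/eqP => [|->]; last exact: qnormsq0.
rewrite /qnormsq => /eqP; rewrite !paddr_eq0 ?addr_ge0 ?sqr_ge0 // !sqrf_eq0.
by case: x => a b c d /= /andP[/andP[/andP[/eqP-> /eqP->] /eqP->] /eqP->].
Qed.

Lemma qmul_eq0 x y : (x * y == 0) = (x == 0) || (y == 0).
Proof. by rewrite -!qnormsq_eq0 qnormsqM mulf_eq0. Qed.

Lemma qre_mul_conj_le x y : qre (x * qconj y) ^+ 2 <= qnormsq x * qnormsq y.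
Proof.
rewrite -(qnormsq_conj y) -qnormsqM [leRHS]/qnormsq -!addrA lerDl.
by rewrite !addr_ge0 ?sqr_ge0.
Qed.

(** Cauchy-Schwarz, adding one term at a time: the cross term of the square
    norm of a sum is at most twice a geometric mean, hence at most the sum of
    the two cross products on the right-hand side. *)
Lemma qnormsq_sum_mul_le (I : Type) (s : seq I) (a b : I -> quat R) :
  qnormsq (\sum_(p <- s) a p * b p)
  <= (\sum_(p <- s) qnormsq (a p)) * (\sum_(p <- s) qnormsq (b p)).
Proof.
elim: s => [|p s IHs]; first by rewrite !big_nil qnormsq0 mulr0.
rewrite !big_cons qnormsqD qnormsqM.
set x := \sum_(q <- s) _ in IHs *; set X := \sum_(q <- s) _ in IHs *.
set Y := \sum_(q <- s) qnormsq (b q) in IHs *.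
have X0 : 0 <= X by apply: sumr_ge0 => q _; exact: qnormsq_ge0.
have Y0 : 0 <= Y by apply: sumr_ge0 => q _; exact: qnormsq_ge0.
have := qre_mul_conj_le (a p * b p) x; rewrite qnormsqM.
set c := qre _; set u := qnormsq (a p); set v := qnormsq (b p) => c_le.
have u0 : 0 <= u by exact: qnormsq_ge0.
have v0 : 0 <= v by exact: qnormsq_ge0.
have c_geom : c ^+ 2 <= (u * Y) * (X * v).
  apply: le_trans c_le _; rewrite [leRHS](_ : _ = u * v * (X * Y)); last by ring.
  by rewrite ler_wpM2l ?mulr_ge0.
suff : 2 * c <= u * Y + X * v by rewrite mulrDl !mulrDr; lra.
have : 0 <= u * Y by rewrite mulr_ge0.
have : 0 <= X * v by rewrite mulr_ge0.
move: (u * Y) (X * v) c_geom => g h c_geom h0 g0.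
apply: le_trans (ler_norm _) _.
rewrite -(ler_pXn2r (_ : 0 < 2)%N) ?nnegrE ?addr_ge0 // real_normK ?num_real //.
by have := sqr_ge0 (g - h); nra.
Qed.

End QuaternionNorm.

(** * The real inner product of quaternion matrices *)

Section MatrixInnerProduct.
Context {R : comNzRingType}.

Lemma ctrmxM m n p (A : 'M[quat R]_(m, n)) (B : 'M[quat R]_(n, p)) :
  ctrmx (A *m B) = ctrmx B *m ctrmx A.
Proof.
apply/matrixP => i j; rewrite !mxE raddf_sum; apply: eq_bigr => k _.
by rewrite !mxE; exact: qconjM.
Qed.

Lemma ctrmxK m n (A : 'M[quat R]_(m, n)) : ctrmx (ctrmx A) = A.
Proof. by apply/matrixP => i j; rewrite !mxE qconjK. Qed.

Definition mdot m n (X Y : 'M[quat R]_(m, n)) : R := qre (\tr (X *m ctrmx Y)).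

Lemma qre_mxtrace_mulC m n (A : 'M[quat R]_(m, n)) (B : 'M[quat R]_(n, m)) :
  qre (\tr (A *m B)) = qre (\tr (B *m A)).
Proof.
have trE p q (X : 'M[quat R]_(p, q)) Y :
    qre (\tr (X *m Y)) = \sum_i \sum_j qre (X i j * Y j i).
  rewrite raddf_sum; apply: eq_bigr => i _.
  by rewrite mxE raddf_sum.
rewrite !trE exchange_big; apply: eq_bigr => j _; apply: eq_bigr => i _.
exact: qre_mulC.
Qed.

Lemma mdotMr m n p (X : 'M[quat R]_(m, p)) (D : 'M_(m, n)) (B : 'M_(n, p)) :
  mdot X (D *m B) = mdot (X *m ctrmx B) D.
Proof. by rewrite /mdot ctrmxM mulmxA. Qed.

Lemma mdotMl m n p (X : 'M[quat R]_(m, p)) (A : 'M_(m, n)) (D : 'M_(n, p)) :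
  mdot X (A *m D) = mdot (ctrmx A *m X) D.
Proof. by rewrite /mdot ctrmxM mulmxA qre_mxtrace_mulC mulmxA. Qed.

Lemma mdotE m n (X Y : 'M[quat R]_(m, n)) :
  mdot X Y = \sum_i \sum_j qre (X i j * qconj (Y i j)).
Proof.
rewrite /mdot raddf_sum; apply: eq_bigr => i _; rewrite mxE raddf_sum /=.
by apply: eq_bigr => j _; rewrite !mxE.
Qed.

Lemma mdotDl m n (X Y Z : 'M[quat R]_(m, n)) :
  mdot (X + Y) Z = mdot X Z + mdot Y Z.
Proof. by rewrite /mdot mulmxDl !raddfD. Qed.

Lemma mdotZl m n a (X Y : 'M[quat R]_(m, n)) :
  mdot (qreal a *: X) Y = a * mdot X Y.
Proof.
rewrite /mdot -scalemxAl mxtraceZ; exact: qre_qrealM.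
Qed.

End MatrixInnerProduct.

Section FrobeniusNorm.
Context {R : rcfType}.

Lemma mfrob_sq m n (A : 'M[quat R]_(m, n)) :
  mfrob A ^+ 2 = \sum_i \sum_j qnormsq (A i j).
Proof.
rewrite sqr_sqrtr // sumr_ge0 // => i _; rewrite sumr_ge0 // => j _.
exact: qnormsq_ge0.
Qed.

Lemma mdot_sq m n (A : 'M[quat R]_(m, n)) : mdot A A = mfrob A ^+ 2.
Proof.
rewrite mfrob_sq mdotE; apply: eq_bigr => i _; apply: eq_bigr => j _.
by rewrite qnormsqE.
Qed.

Lemma mfrob_sqD m n (X Y : 'M[quat R]_(m, n)) :
  mfrob (X + Y) ^+ 2 = mfrob X ^+ 2 + 2 * mdot X Y + mfrob Y ^+ 2.
Proof.
rewrite !mfrob_sq mdotE mulr_sumr -!big_split; apply: eq_bigr => i _ /=.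
rewrite mulr_sumr -!big_split; apply: eq_bigr => j _ /=.
by rewrite !mxE qnormsqD.
Qed.

Lemma mfrob_sqZ m n a (X : 'M[quat R]_(m, n)) :
  mfrob (qreal a *: X) ^+ 2 = a ^+ 2 * mfrob X ^+ 2.
Proof.
rewrite !mfrob_sq mulr_sumr; apply: eq_bigr => i _.
rewrite mulr_sumr; apply: eq_bigr => j _.
by rewrite !mxE -(qnormsq_qreal a); exact: qnormsqM.
Qed.

Lemma mfrob_sqN m n (X : 'M[quat R]_(m, n)) : mfrob (- X) ^+ 2 = mfrob X ^+ 2.
Proof.
rewrite !mfrob_sq; apply: eq_bigr => i _; apply: eq_bigr => j _.
by rewrite mxE /qnormsq /= !sqrrN.
Qed.

Lemma mfrob_sq_eq0 m n (X : 'M[quat R]_(m, n)) :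
  (mfrob X ^+ 2 == 0) = (X == 0).
Proof.
apply/eqP/eqP => [|->]; last first.
  by rewrite mfrob_sq big1 // => i _; rewrite big1 // => j _; rewrite mxE qnormsq0.
rewrite mfrob_sq => /eqP; rewrite psumr_eq0; last first.
  by move=> i _; rewrite sumr_ge0 // => j _; exact: qnormsq_ge0.
move=> /allP X0; apply/matrixP => i j; rewrite mxE; apply/eqP.
have /= := X0 i (mem_index_enum i); rewrite psumr_eq0; last first.
  by move=> k _; exact: qnormsq_ge0.
by move=> /allP/(_ j (mem_index_enum j)); rewrite /= qnormsq_eq0.
Qed.

Lemma mfrob_sq_le_sub m n (X Y : 'M[quat R]_(m, n)) :
  mfrob Y ^+ 2 <= 2 * mfrob (X - Y) ^+ 2 + 2 * mfrob X ^+ 2.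
Proof.
rewrite !mfrob_sq !mulr_sumr -big_split; apply: ler_sum => i _ /=.
rewrite !mulr_sumr -big_split; apply: ler_sum => j _ /=; rewrite !mxE.
(* The difference of the two sides is [|2 x - y|^2]. *)
have := qnormsq_ge0 (X i j + (X i j - Y i j)); rewrite /qnormsq /=.
by lra.
Qed.

Lemma mfrob_sqM_le m n p (A : 'M[quat R]_(m, n)) (B : 'M[quat R]_(n, p)) :
  mfrob (A *m B) ^+ 2 <= mfrob A ^+ 2 * mfrob B ^+ 2.
Proof.
rewrite !mfrob_sq mulr_suml; apply: ler_sum => i _.
rewrite [X in _ * X]exchange_big /= mulr_sumr; apply: ler_sum => j _.
by rewrite mxE; exact: qnormsq_sum_mul_le.
Qed.

End FrobeniusNorm.

(** * Invertible quaternion matrices *)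

Lemma mulmx_qrealZr (R : comNzRingType) m n p (A : 'M[quat R]_(m, n))
    (B : 'M_(n, p)) a :
  A *m (qreal a *: B) = qreal a *: (A *m B).
Proof.
apply/matrixP => i j; rewrite !mxE mulr_sumr; apply: eq_bigr => k _.
by rewrite mxE !mulrA qrealC.
Qed.

(** Determinants being unavailable over a skew field, invertibility comes from
    counting real dimensions: left multiplication by [G] is an injective real
    endomorphism of the real vector space of square matrices, so it is onto and
    reaches the identity matrix. The right inverse [W] so obtained is also a
    left inverse, since [G *m (W *m G - 1)] vanishes. *)
Lemma mulmx_inj_inverse (R : fieldType) n (G : 'M[quat R]_n) :
  (forall X : 'M_n, G *m X = 0 -> X = 0) ->
  exists W : 'M_n, G *m W = 1%:M /\ W *m G = 1%:M.
Proof.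
move=> G_inj.
pose V := {ffun 'I_n * 'I_n -> (R^o * R^o * R^o * R^o)%type}.
pose dec (x : V) : 'M[quat R]_n := \matrix_(i, j) tuple_quat (x (i, j)).
pose enc (X : 'M[quat R]_n) : V := [ffun p => quat_tuple (X p.1 p.2)].
have encK : cancel enc dec.
  by move=> X; apply/matrixP => i j; rewrite !mxE ffunE; case: (X i j).
have decK : cancel dec enc.
  move=> x; apply/ffunP => -[i j]; rewrite !ffunE /= mxE.
  by case: (x (i, j)) => [[[? ?] ?] ?].
have decP a x y : dec (a *: x + y) = qreal a *: dec x + dec y.
  apply/matrixP => i j; rewrite !mxE !ffunE.
  case: (x (i, j)) (y (i, j)) => [[[? ?] ?] ?] [[[? ?] ?] ?].
  by apply: quat_ext; rewrite /= /GRing.scale /=; ring.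
have encP a X Y : enc (qreal a *: X + Y) = a *: enc X + enc Y.
  apply/ffunP => p; rewrite !ffunE !mxE.
  case: (X p.1 p.2) (Y p.1 p.2) => [? ? ? ?] [? ? ? ?].
  by congr (_, _, _, _); rewrite /= /GRing.scale /=; ring.
pose L (x : V) : V := enc (G *m dec x).
have L_lin : linear L.
  by move=> a x y; rewrite /L decP mulmxDr mulmx_qrealZr encP.
pose LL := GRing.isLinear.Build R V V *:%R L L_lin.
pose L' : {linear V -> V} := HB.pack L LL.
have L_inj : lker (linfun L') == 0%VS.
  apply/lker0P => x y; rewrite !lfunE /= => /(can_inj encK) eqG.
  apply: (can_inj decK); apply/eqP; rewrite -subr_eq0; apply/eqP/G_inj.
  by rewrite mulmxBr eqG subrr.
have [W GW] : exists W : 'M_n, G *m W = 1%:M.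
  exists (dec ((linfun L')^-1%VF (enc 1%:M))); apply: (can_inj encK).
  by rewrite -[LHS]/(L' _) -lfunE lker0_lfunVK.
exists W; split=> //; apply/eqP; rewrite -subr_eq0; apply/eqP/G_inj.
by rewrite mulmxBr mulmxA GW mul1mx mulmx1 subrr.
Qed.

(** When an inverse exists at all, the choice made by [qinvmx] is one. *)
Lemma qinvmxP (R : fieldType) n (G : 'M[quat R]_n) :
  (forall X : 'M_n, G *m X = 0 -> X = 0) ->
  G *m qinvmx G = 1%:M /\ qinvmx G *m G = 1%:M.
Proof.
move=> /mulmx_inj_inverse [W GW]; rewrite /qinvmx.
by case: xgetP => [V _ //|/(_ W)] /(_ GW).
Qed.

Section RegularizedGram.
Context {R : rcfType}.

(** The regularized Gram matrices of the two factor updates are positive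
    definite, since the inner product of [X] and [(A^* A + c) X] is
    [|A X|^2 + c |X|^2]. *)
Lemma gram_reg_inj m n p (A : 'M[quat R]_(m, n)) (c : R) (X : 'M_(n, p)) :
  0 < c -> (ctrmx A *m A + (qreal c)%:M) *m X = 0 -> X = 0.
Proof.
move=> c0 /(congr1 (fun Y => mdot Y X)); rewrite mulmxDl mul_scalar_mx mdotDl mdotZl.
rewrite -mulmxA -mdotMl !mdot_sq /mdot mul0mx !raddf0 => /eqP.
rewrite paddr_eq0 ?sqr_ge0 //; last by rewrite mulr_ge0 ?sqr_ge0 ?ltW.
by rewrite (mulf_eq0 c) (gt_eqF c0) /= !mfrob_sq_eq0 => /andP[_ /eqP].
Qed.

Lemma gram_reg_mulK m n p (A : 'M[quat R]_(m, n)) (c : R) (Y : 'M_(n, p)) :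
  0 < c ->
  (ctrmx A *m A + (qreal c)%:M) *m
    (qinvmx (ctrmx A *m A + (qreal c)%:M) *m Y) = Y.
Proof.
move=> c0; rewrite mulmxA (qinvmxP _).1 ?mul1mx // => X.
exact: gram_reg_inj.
Qed.

Lemma gram_reg_mulVK m n p (B : 'M[quat R]_(n, m)) (c : R) (Y : 'M_(p, n)) :
  0 < c ->
  Y *m qinvmx (B *m ctrmx B + (qreal c)%:M) *m
    (B *m ctrmx B + (qreal c)%:M) = Y.
Proof.
move=> c0; rewrite -mulmxA (qinvmxP _).2 ?mulmx1 // => X.
by rewrite -{1}(ctrmxK B); exact: gram_reg_inj.
Qed.

End RegularizedGram.

(** * The quaternion Fourier transform *)

Section Fourier.
Context {R : realType}.
Variable mu : quat R.
Hypothesis mu_unit : unit_pure mu.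

Lemma unit_pure_sqr : mu * mu = -1.
Proof.
case: mu_unit => mu0 /(congr1 (fun x => x ^+ 2)).
rewrite sqr_sqrtr ?qnormsq_ge0 // expr1n.
case: mu mu0 => a b c d /= -> norm1.
by apply: quat_ext; rewrite /= -?norm1 /qnormsq /=; ring.
Qed.

(** The exponential of [- mu * x]. All its values lie in the commutative
    subring generated by [mu], where the usual theory of roots of unity
    applies. *)
Definition qexp (x : R) : quat R := qreal (cos x) - mu * qreal (sin x).

Lemma qexpD x y : qexp (x + y) = qexp x * qexp y.
Proof.
have qrealM (a b : R) : qreal (a * b) = qreal a * qreal b by rewrite rmorphM.
rewrite /qexp cosD sinD; move: (cos x) (sin x) (cos y) (sin y) => a b c d.
have -> : (qreal a - mu * qreal b) * (qreal c - mu * qreal d)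
    = qreal a * qreal c + (mu * mu) * (qreal b * qreal d)
      - mu * (qreal b * qreal c + qreal a * qreal d).
  by apply: quat_ext => /=; ring.
by rewrite unit_pure_sqr mulN1r -!qrealM -!raddfD -raddfB.
Qed.

Lemma qexp0 : qexp 0 = 1.
Proof. by rewrite /qexp cos0 sin0 raddf0 mulr0 subr0. Qed.

Lemma qexpX x n : qexp (x *+ n) = qexp x ^+ n.
Proof.
by elim: n => [|n IHn]; rewrite ?mulr0n ?qexp0 // mulrS exprS qexpD IHn.
Qed.

Lemma qexp_2pi n : qexp (2 * pi * n%:R) = 1.
Proof.
have -> : 2 * pi * n%:R = (pi *+ 2) *+ n :> R.
  by rewrite -(mulr_natl pi) mulr_natr.
by rewrite qexpX {1}/qexp cos2pi sin2pi raddf0 mulr0 subr0 expr1n.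
Qed.

Lemma qconj_qexp x : qconj (qexp x) = qexp (- x).
Proof.
rewrite /qexp cosN sinN; case: mu mu_unit => a b c d [/= -> _].
by apply: quat_ext => /=; ring.
Qed.

Lemma qre_qexp x : qre (qexp x) = cos x.
Proof. by rewrite /qexp; case: mu mu_unit => a b c d [/= -> _]; ring. Qed.

Lemma cos_neq1 (x : R) : 0 < x < pi *+ 2 -> cos x != 1.
Proof.
move=> /andP[x0 x2].
have -> : x = (x / 2) *+ 2 by rewrite -mulr_natr; field.
rewrite cos_mulr2n cos2sin2.
have : 0 < sin (x / 2).
  apply: sin_gt0_pi; rewrite divr_gt0 //=.
  by rewrite ltr_pdivrMr // mulr_natr.
by move=> s0; apply/eqP; have := mulr_gt0 s0 s0; nra.
Qed.

(** The orthogonality of characters: for distinct [p] and [q] the sum is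
    geometric, with a ratio [w] that differs from [1] and satisfies
    [w ^+ n = 1]. *)
Lemma sum_qexp n (p q : 'I_n) :
  \sum_(k < n) qexp ((2 * pi * (q%:R - p%:R) / n%:R) *+ k)
  = qreal ((p == q)%:R * n%:R).
Proof.
have n_gt0 : (0 < n)%N by rewrite (leq_ltn_trans _ (ltn_ord p)).
have n0 : n%:R != 0 :> R by rewrite pnatr_eq0 -lt0n.
set x := 2 * pi * _ / _.
have [eq_pq|ne_pq] := eqVneq p q.
  rewrite /x eq_pq subrr mulr0 mul0r mul1r.
  under eq_bigr => k _ do rewrite mul0rn qexp0.
  by rewrite sumr_const card_ord rmorph_nat.
under eq_bigr => k _ do rewrite qexpX.
rewrite mul0r raddf0.
have wn : qexp x ^+ n - 1 = 0.
  rewrite -qexpX; have -> : x *+ n = 2 * pi * q%:R - 2 * pi * p%:R.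
    by rewrite -mulr_natr /x -mulrBr; field.
  by rewrite qexpD -qconj_qexp !qexp_2pi mul1r [qconj 1](_ : _ = 1) ?subrr //;
    apply: quat_ext => /=; rewrite ?oppr0.
have : (qexp x - 1) * (\sum_(k < n) qexp x ^+ k) == 0 by rewrite -subrX1 wn.
rewrite qmul_eq0 => /orP[|/eqP//].
rewrite subr_eq0 => /eqP/(congr1 (@qre R)); rewrite qre_qexp => /eqP.
have cosE d : (0 < d < n)%N -> cos (2 * pi * d%:R / n%:R) != 1 :> R.
  move=> /andP[d0 dn]; apply: cos_neq1.
  rewrite divr_gt0 ?mulr_gt0 ?pi_gt0 ?ltr0n //= ltr_pdivrMr ?ltr0n //.
  by rewrite -[pi *+ 2]mulr_natl ltr_pM2l ?mulr_gt0 ?pi_gt0 // ltr_nat.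
have ltn_subn (a b : 'I_n) : (a < b)%N -> (0 < b - a < n)%N.
  by move=> ab; rewrite subn_gt0 ab (leq_ltn_trans (leq_subr _ _) (ltn_ord b)).
have [lt_pq|lt_qp|/val_inj eq_pq] := ltngtP p q; last by rewrite eq_pq eqxx in ne_pq.
- by rewrite /x -natrB 1?ltnW // (negPf (cosE _ (ltn_subn _ _ lt_pq))).
- rewrite -cosN (_ : - x = 2 * pi * (p%:R - q%:R) / n%:R); last first.
    by rewrite /x -mulNr -mulrN opprB.
  by rewrite -natrB 1?ltnW // (negPf (cosE _ (ltn_subn _ _ lt_qp))).
Qed.

Lemma qdft_mxE n (p q : 'I_n) :
  qdft_mx mu n p q
  = qreal (Num.sqrt n%:R)^-1 * qexp (2 * pi * p%:R * q%:R / n%:R).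
Proof. by rewrite mxE. Qed.

Lemma qdft_mx_unitary n : ctrmx (qdft_mx mu n) *m qdft_mx mu n = 1%:M.
Proof.
apply/matrixP => p q; rewrite mxE [RHS]mxE.
have n0 : n%:R != 0 :> R by rewrite pnatr_eq0 -lt0n (leq_ltn_trans _ (ltn_ord p)).
under eq_bigr => k _.
  rewrite [ctrmx _ p k]mxE [_^T p k]mxE !qdft_mxE qconjM qconj_qexp.
  rewrite (_ : qconj (qreal _) = qreal (Num.sqrt n%:R)^-1); last first.
    by apply: quat_ext => //=; rewrite oppr0.
  rewrite -qrealC -mulrA (mulrA (qexp _)) -(qrealC _ (qexp _)) -mulrA mulrA.
  rewrite -rmorphM -invfM -expr2 sqr_sqrtr ?ler0n // -qexpD.
  rewrite (_ : _ + _ = (2 * pi * (q%:R - p%:R) / n%:R) *+ k); last first.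
    by rewrite -mulr_natr; field.
  over.
rewrite -mulr_sumr sum_qexp -rmorphM mulrCA mulVf // mulr1.
by case: (p == q).
Qed.

Lemma qdft_mx_inverse n :
  exists W : 'M[quat R]_n, qdft_mx mu n *m W = 1%:M.
Proof.
have [|W [FW _]] := @mulmx_inj_inverse _ _ (qdft_mx mu n); last by exists W.
by move=> X FX; rewrite -[X]mul1mx -(qdft_mx_unitary n) -mulmxA FX mulmx0.
Qed.

Section Transform.
Variables n1 n2 n3 : nat.
Local Notation qtensor := (tensor (quat R) n1 n2 n3).

Lemma tfrob_sq (X : qtensor) : tfrob X ^+ 2 = \sum_l mfrob (X l) ^+ 2.
Proof. by rewrite sqr_sqrtr // sumr_ge0 // => l _; exact: sqr_ge0. Qed.

Lemma tfrob_sqE (X : qtensor) :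
  tfrob X ^+ 2 = \sum_l \sum_i \sum_j qnormsq (X l i j).
Proof. by rewrite tfrob_sq; apply: eq_bigr => l _; rewrite mfrob_sq. Qed.

Lemma qdftE (X : qtensor) l i j :
  qdft mu X l i j
  = qreal (Num.sqrt n3%:R) * \sum_k qdft_mx mu n3 l k * X k i j.
Proof.
rewrite ffunE mxE [LHS]mxE mxE; congr (_ * _).
by apply: eq_bigr => k _; rewrite [tube _ _ _ _ _]mxE.
Qed.

Lemma mxBE m n (X Y : 'M[quat R]_(m, n)) i j : (X - Y) i j = X i j - Y i j.
Proof. by rewrite !mxE. Qed.

Lemma tensorBE (X Y : qtensor) l i j : (X - Y) l i j = X l i j - Y l i j.
Proof. by rewrite (ffunE _ l) mxE (ffunE _ l) mxE. Qed.

Lemma qdftB (X Y : qtensor) l : qdft mu (X - Y) l = qdft mu X l - qdft mu Y l.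
Proof.
apply/matrixP => i j; rewrite [RHS]mxBE [LHS]qdftE.
rewrite [Z in _ = Z - _]qdftE [Z in _ = _ - Z]qdftE -mulrBr -sumrB.
by congr (_ * _); apply: eq_bigr => k _; rewrite tensorBE mulrBr.
Qed.

Lemma qdft_parseval (X : qtensor) :
  \sum_l mfrob (qdft mu X l) ^+ 2 = n3%:R * tfrob X ^+ 2.
Proof.
have tubes (Y : qtensor) : \sum_l mfrob (Y l) ^+ 2
    = \sum_i \sum_j mfrob (tube Y i j) ^+ 2.
  rewrite -tfrob_sq tfrob_sqE exchange_big; apply: eq_bigr => i _ /=.
  rewrite exchange_big; apply: eq_bigr => j _ /=; rewrite mfrob_sq.
  by apply: eq_bigr => l _; rewrite big_ord1 mxE.
rewrite tfrob_sq !tubes mulr_sumr; apply: eq_bigr => i _.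
rewrite mulr_sumr; apply: eq_bigr => j _.
rewrite (_ : tube (qdft mu X) i j
    = qreal (Num.sqrt n3%:R) *: (qdft_mx mu n3 *m tube X i j)); last first.
  by apply/colP => l; rewrite [LHS]mxE ffunE [LHS]mxE.
rewrite mfrob_sqZ sqr_sqrtr ?ler0n // -!mdot_sq mdotMl mulmxA.
by rewrite qdft_mx_unitary mul1mx.
Qed.

Lemma qdft_surj (Y : forall l : 'I_n3, 'M[quat R]_(n1, n2)) :
  (0 < n3)%N -> exists X : qtensor, forall l, qdft mu X l = Y l.
Proof.
move=> n3_gt0; have [W FW] := qdft_mx_inverse n3.
pose y i j : 'cV[quat R]_n3 := \col_l Y l i j.
pose c := Num.sqrt (n3%:R : R).
exists [ffun l => \matrix_(i, j) (qreal c^-1 *: (W *m y i j)) l 0] => l.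
apply/matrixP => i j; rewrite ffunE mxE.
rewrite (_ : tube _ i j = qreal c^-1 *: (W *m y i j)); last first.
  by apply/colP => k; rewrite mxE ffunE mxE.
rewrite mulmx_qrealZr mulmxA FW mul1mx scalerA -rmorphM divff.
  by rewrite rmorph1 scale1r mxE.
by rewrite /c sqrtr_eq0 -ltNge ltr0n.
Qed.

(** Surjectivity makes [qprod] a genuine preimage, so that by Parseval the data
    term of the objective splits into one least-squares term per frontal slice
    of the transforms. *)
Lemma qdft_qprod (r : 'I_n3 -> nat) (A : forall l, 'M[quat R]_(n1, r l))
    (B : forall l, 'M[quat R]_(r l, n2)) :
  (0 < n3)%N -> forall l, qdft mu (qprod mu A B) l = A l *m B l.
Proof.
move=> n3_gt0; have [X XP] := qdft_surj (fun l => A l *m B l) n3_gt0.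
pose P (Z : qtensor) := forall l, qdft mu Z l = A l *m B l.
exact: (@xgetI _ 0 P X XP).
Qed.

Lemma qprod_parseval (r : 'I_n3 -> nat) (A : forall l, 'M[quat R]_(n1, r l))
    (B : forall l, 'M[quat R]_(r l, n2)) (C : qtensor) :
  (0 < n3)%N ->
  n3%:R * tfrob (qprod mu A B - C) ^+ 2
  = \sum_l mfrob (A l *m B l - qdft mu C l) ^+ 2.
Proof.
move=> n3_gt0; rewrite -qdft_parseval; apply: eq_bigr => l _.
by congr (mfrob _ ^+ 2); rewrite -(qdft_qprod A B n3_gt0); exact: qdftB.
Qed.

End Transform.

End Fourier.

(** * Decrease in a regularized least-squares update *)

Section RidgeSteps.
Context {R : rcfType}.
Variables (lambda beta : R).
Hypotheses (lambda_gt0 : 0 < lambda) (beta_gt0 : 0 < beta).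

Lemma normal_eq_residual (V : zmodType) (h l b1 c b0 : V) :
  h + (l + b1) = c + b0 -> h - c + l = b0 - b1.
Proof.
move=> eq_hc; rewrite addrAC; apply/eqP.
by rewrite subr_eq addrAC eq_sym subr_eq -addrA eq_hc addrC.
Qed.

(** The new factor [A1] solves the normal equation
    [(A1 B - C) B^* + lambda A1 = beta (A0 - A1)]. In the expansion of the
    objective at [A0] around [A1], that makes the first-order term equal to
    [2 beta |A0 - A1|^2], while the second-order term is at least
    [lambda |A0 - A1|^2]. *)
Lemma ridge_left_decrease m n k (A0 : 'M[quat R]_(m, k)) (B : 'M_(k, n))
    (C : 'M_(m, n)) A1 :
  A1 = (C *m ctrmx B + qreal beta *: A0)
       *m qinvmx (B *m ctrmx B + (qreal (lambda + beta))%:M) ->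
  (2 * beta + lambda) * mfrob (A0 - A1) ^+ 2
  <= mfrob (A0 *m B - C) ^+ 2 + lambda * mfrob A0 ^+ 2
     - (mfrob (A1 *m B - C) ^+ 2 + lambda * mfrob A1 ^+ 2).
Proof.
move=> A1E.
have : A1 *m (B *m ctrmx B + (qreal (lambda + beta))%:M)
    = C *m ctrmx B + qreal beta *: A0.
  by rewrite A1E gram_reg_mulVK ?addr_gt0.
rewrite mulmxDr -scalemx1 mulmx_qrealZr mulmx1 rmorphD scalerDl => normal_eq.
set D := A0 - A1.
have grad : (A1 *m B - C) *m ctrmx B + qreal lambda *: A1 = qreal beta *: D.
  by rewrite mulmxBl /D scalerBr -mulmxA; exact: normal_eq_residual normal_eq.
have A0E : A0 = A1 + D by rewrite /D addrC subrK.
clearbody D.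
have -> : A0 *m B - C = (A1 *m B - C) + D *m B by rewrite A0E mulmxDl addrAC.
rewrite A0E (mfrob_sqD (A1 *m B - C)) (mfrob_sqD A1) mdotMr.
have /(congr1 (fun X => mdot X D)) := grad.
rewrite mdotDl !mdotZl mdot_sq => gradD.
have := sqr_ge0 (mfrob (D *m B)); move: gradD.
move: (mdot ((A1 *m B - C) *m ctrmx B) D) (mdot A1 D) => u v.
move: (mfrob (A1 *m B - C) ^+ 2) (mfrob (D *m B) ^+ 2) => x y.
move: (mfrob A1 ^+ 2) (mfrob D ^+ 2) => a d.
by lra.
Qed.

Lemma ridge_right_decrease m n k (A : 'M[quat R]_(m, k)) (B0 : 'M_(k, n))
    (C : 'M_(m, n)) B1 :
  B1 = qinvmx (ctrmx A *m A + (qreal (lambda + beta))%:M)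
       *m (ctrmx A *m C + qreal beta *: B0) ->
  (2 * beta + lambda) * mfrob (B0 - B1) ^+ 2
  <= mfrob (A *m B0 - C) ^+ 2 + lambda * mfrob B0 ^+ 2
     - (mfrob (A *m B1 - C) ^+ 2 + lambda * mfrob B1 ^+ 2).
Proof.
move=> B1E.
have : (ctrmx A *m A + (qreal (lambda + beta))%:M) *m B1
    = ctrmx A *m C + qreal beta *: B0.
  by rewrite B1E gram_reg_mulK ?addr_gt0.
rewrite mulmxDl mul_scalar_mx -mulmxA rmorphD scalerDl => normal_eq.
set D := B0 - B1.
have grad : ctrmx A *m (A *m B1 - C) + qreal lambda *: B1 = qreal beta *: D.
  by rewrite mulmxBr /D scalerBr; exact: normal_eq_residual normal_eq.
have B0E : B0 = B1 + D by rewrite /D addrC subrK.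
clearbody D.
have -> : A *m B0 - C = (A *m B1 - C) + A *m D by rewrite B0E mulmxDr addrAC.
rewrite B0E (mfrob_sqD (A *m B1 - C)) (mfrob_sqD B1) mdotMl.
have /(congr1 (fun X => mdot X D)) := grad.
rewrite mdotDl !mdotZl mdot_sq => gradD.
have := sqr_ge0 (mfrob (A *m D)); move: gradD.
move: (mdot (ctrmx A *m (A *m B1 - C)) D) (mdot B1 D) => u v.
move: (mfrob (A *m B1 - C) ^+ 2) (mfrob (A *m D) ^+ 2) => x y.
move: (mfrob B1 ^+ 2) (mfrob D ^+ 2) => a d.
by lra.
Qed.

End RidgeSteps.

(** * Convexity in the completion variable *)

Section Convexity.
Context {R : realType} {n1 n2 n3 : nat}.
Local Notation qtensor := (tensor (quat R) n1 n2 n3).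

Lemma qnormsq_comb (s : R) (x y : quat R) :
  qnormsq (qreal s * x + qreal (1 - s) * y)
  = s * qnormsq x + (1 - s) * qnormsq y - s * (1 - s) * qnormsq (x - y).
Proof. by rewrite /qnormsq /=; ring. Qed.

Lemma mfrob_sq_comb_le m n (s : R) (X Y : 'M[quat R]_(m, n)) :
  0 <= s <= 1 ->
  mfrob (qreal s *: X + qreal (1 - s) *: Y) ^+ 2
  <= s * mfrob X ^+ 2 + (1 - s) * mfrob Y ^+ 2.
Proof.
move=> /andP[s0 s1]; rewrite !mfrob_sq !mulr_sumr -big_split.
apply: ler_sum => i _ /=; rewrite !mulr_sumr -big_split.
apply: ler_sum => j _ /=; rewrite !mxE qnormsq_comb gerDl oppr_le0.
by rewrite !mulr_ge0 ?subr_ge0 ?qnormsq_ge0.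
Qed.

Lemma tensor_ext (T : Type) (X Y : tensor T n1 n2 n3) :
  (forall l i j, X l i j = Y l i j) -> X = Y.
Proof. by move=> eqXY; apply/ffunP => l; apply/matrixP => i j. Qed.

Lemma tproj_eq0 (Omega : {set 'I_n1 * 'I_n2 * 'I_n3}) (X : qtensor) :
  tproj Omega X = 0 <-> forall l i j, (i, j, l) \in Omega -> X l i j = 0.
Proof.
split=> [X0 l i j inO|X0].
  have := congr1 (fun T : qtensor => T l i j) X0.
  by rewrite !ffunE !mxE inO.
apply: tensor_ext => l i j; rewrite !ffunE !mxE.
by case: ifP => // /X0.
Qed.

Lemma tpart_eq0 (X : qtensor) :
  tpart (@qre R) X = 0 <-> forall l i j, qre (X l i j) = 0.
Proof.
split=> [X0 l i j|X0].
  have := congr1 (fun T : tensor R n1 n2 n3 => T l i j) X0.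
  by rewrite !ffunE !mxE.
by apply: tensor_ext => l i j; rewrite !ffunE !mxE.
Qed.

(** Convex combinations of tensors, described entrywise. *)
Definition is_tcomb (s : R) (X Y Z : qtensor) : Prop :=
  forall l i j, Z l i j = qreal s * X l i j + qreal (1 - s) * Y l i j.

Lemma tcomb_exists s X Y : exists Z, is_tcomb s X Y Z.
Proof.
exists [ffun l => qreal s *: X l + qreal (1 - s) *: Y l] => l i j.
by rewrite ffunE !mxE.
Qed.

Lemma tfrob_sq_comb (s : R) (X Y Z D : qtensor) :
  is_tcomb s X Y Z -> (forall l i j, D l i j = X l i j - Y l i j) ->
  tfrob Z ^+ 2
  = s * tfrob X ^+ 2 + (1 - s) * tfrob Y ^+ 2 - s * (1 - s) * tfrob D ^+ 2.
Proof.
move=> ZE DE; rewrite !tfrob_sqE !mulr_sumr -big_split -sumrB.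
apply: eq_bigr => l _ /=; rewrite !mulr_sumr -big_split -sumrB.
apply: eq_bigr => i _ /=; rewrite !mulr_sumr -big_split -sumrB.
by apply: eq_bigr => j _ /=; rewrite ZE DE qnormsq_comb.
Qed.

Lemma TV_comb_le (lambda1 lambda2 s : R) (X Y Z : qtensor) :
  0 <= lambda1 -> 0 <= lambda2 -> 0 <= s <= 1 -> is_tcomb s X Y Z ->
  TV lambda1 lambda2 Z
  <= s * TV lambda1 lambda2 X + (1 - s) * TV lambda1 lambda2 Y.
Proof.
move=> l1 l2 s01 ZE; rewrite /TV.
set h := \sum_(k | _) _; set v := \sum_(k | _) _.
set hX := \sum_(k | _) _; set vX := \sum_(k | _) _.
set hY := \sum_(k | _) _; set vY := \sum_(k | _) _.
have hle : h <= s * hX + (1 - s) * hY.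
  rewrite !mulr_sumr -big_split; apply: ler_sum => k _ /=.
  apply: le_trans (mfrob_sq_comb_le _ _ s01); rewrite le_eqVlt; apply/orP; left.
  apply/eqP; congr (mfrob _ ^+ 2); apply/matrixP => j l.
  by rewrite !mxE !ZE; apply: quat_ext => /=; ring.
have vle : v <= s * vX + (1 - s) * vY.
  rewrite !mulr_sumr -big_split; apply: ler_sum => k _ /=.
  apply: le_trans (mfrob_sq_comb_le _ _ s01); rewrite le_eqVlt; apply/orP; left.
  apply/eqP; congr (mfrob _ ^+ 2); apply/matrixP => j l.
  by rewrite !mxE !ZE; apply: quat_ext => /=; ring.
have := ler_wpM2l l1 hle; have := ler_wpM2l l2 vle.
move: h v hX vX hY vY {hle vle} => h v hX vX hY vY.
by lra.
Qed.

Definition imag_inner (X Y : qtensor) : R :=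
  tinner (tpart (@qi R) X) (tpart (@qi R) Y)
  + tinner (tpart (@qj R) X) (tpart (@qj R) Y)
  + tinner (tpart (@qk R) X) (tpart (@qk R) Y).

Lemma imag_innerE (X Y : qtensor) :
  imag_inner X Y = \sum_l \sum_i \sum_j
    (qi (X l i j) * qi (Y l i j) + qj (X l i j) * qj (Y l i j)
     + qk (X l i j) * qk (Y l i j)).
Proof.
rewrite /imag_inner /tinner -!big_split; apply: eq_bigr => l _ /=.
rewrite -!big_split; apply: eq_bigr => i _ /=.
rewrite -!big_split; apply: eq_bigr => j _ /=.
by rewrite !ffunE !mxE.
Qed.

Lemma imag_inner_comb (s : R) (D X Y Z : qtensor) :
  is_tcomb s X Y Z ->
  imag_inner D Z
  = s * imag_inner D X + (1 - s) * imag_inner D Y.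
Proof.
move=> ZE; rewrite !imag_innerE !mulr_sumr -big_split; apply: eq_bigr => l _ /=.
rewrite !mulr_sumr -big_split; apply: eq_bigr => i _ /=.
rewrite !mulr_sumr -big_split; apply: eq_bigr => j _ /=.
by rewrite ZE /=; ring.
Qed.

(** Young's inequality, with the weights that turn the bound
    [|D| <= |E| / 4] on an error term [D] into [|E|^2 / 4]. *)
Lemma imag_inner_sub_le (D E X Y : qtensor) :
  (forall l i j, E l i j = Y l i j - X l i j) ->
  imag_inner D X - imag_inner D Y
  <= 2 * tfrob D ^+ 2 + 8^-1 * tfrob E ^+ 2.
Proof.
move=> EE; rewrite !imag_innerE !tfrob_sqE !mulr_sumr -sumrB -big_split.
apply: ler_sum => l _ /=; rewrite !mulr_sumr -sumrB -big_split.
apply: ler_sum => i _ /=; rewrite !mulr_sumr -sumrB -big_split.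
apply: ler_sum => j _ /=; rewrite EE /qnormsq !expr2.
have young (d e : R) : d * e <= 2 * (d * d) + 8^-1 * (e * e).
  by have := sqr_ge0 (4 * d - e); lra.
case: (D l i j) (X l i j) (Y l i j) => [d0 d1 d2 d3] [x0 x1 x2 x3] [y0 y1 y2 y3] /=.
have := young d1 (x1 - y1); have := young d2 (x2 - y2).
have := young d3 (x3 - y3);
have : 0 <= d0 * d0 by rewrite -expr2 sqr_ge0.
have : 0 <= (y0 - x0) * (y0 - x0) by rewrite -expr2 sqr_ge0.
by lra.
Qed.

End Convexity.

Section PerturbedMinimum.
Context {R : realType} {n1 n2 n3 : nat}.
Local Notation qtensor := (tensor (quat R) n1 n2 n3).

Lemma is_tcomb_sub (s : R) (P X Y Z : qtensor) :
  is_tcomb s X Y Z -> is_tcomb s (P - X) (P - Y) (P - Z).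
Proof.
move=> ZE l i j; apply: (eq_trans (tensorBE P Z l i j)).
pose comb (x y : quat R) := qreal s * x + qreal (1 - s) * y.
apply: (eq_trans _ (esym (congr2 comb (tensorBE P X l i j) (tensorBE P Y l i j)))).
by rewrite ZE; apply: quat_ext => /=; ring.
Qed.

Lemma C_feasible_comb (M : qtensor) (Omega : {set 'I_n1 * 'I_n2 * 'I_n3})
    (s : R) (X Y Z : qtensor) :
  is_tcomb s X Y Z ->
  C_feasible M Omega X -> C_feasible M Omega Y -> C_feasible M Omega Z.
Proof.
move=> ZE [/tpart_eq0 reX /tproj_eq0 obsX] [/tpart_eq0 reY /tproj_eq0 obsY].
have eq_obs (T : qtensor) l i j : (T - M) l i j = 0 -> T l i j = M l i j.
  by move/(eq_trans (esym (tensorBE T M l i j)))/eqP; rewrite subr_eq0 => /eqP.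
split; first by apply/tpart_eq0 => l i j; rewrite ZE /= reX reY; ring.
apply/tproj_eq0 => l i j inO; apply: (eq_trans (tensorBE Z M l i j)).
rewrite ZE (eq_obs X) ?obsX // (eq_obs Y) ?obsY //.
by apply: quat_ext => /=; ring.
Qed.

Lemma tfrob_tproj_setC (Omega : {set 'I_n1 * 'I_n2 * 'I_n3}) (X : qtensor) :
  tproj Omega X = 0 -> tproj (~: Omega) X = X.
Proof.
move=> /tproj_eq0 X0; apply: tensor_ext => l i j; rewrite ffunE mxE inE.
by case: (boolP (_ \in Omega)) => // /X0.
Qed.

(** The data term makes the perturbed objective [g] strongly convex, and the
    segment from [C1] to [C0] is feasible, so minimality of [C1] against the
    point at parameter [s] gives
    [g C0 - g C1 >= (1 - s) / 2 * |C1 - C0|^2]. Removing the linear perturbation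
    costs at most [|C1 - C0|^2 / 4], so any [s < 1/2] leaves a positive
    multiple; [s = 1/4] leaves [3/8 - 1/4 = 1/8]. *)
Lemma perturbed_min_decrease (lambda1 lambda2 : R) (M P C0 C1 delta : qtensor)
    (Omega : {set 'I_n1 * 'I_n2 * 'I_n3}) :
  let h C := 2^-1 * tfrob (P - C) ^+ 2 + TV lambda1 lambda2 C in
  0 <= lambda1 -> 0 <= lambda2 ->
  tproj Omega delta = 0 ->
  tfrob (tproj (~: Omega) delta) <= 4^-1 * tfrob (C1 - C0) ->
  C_feasible M Omega C0 -> C_feasible M Omega C1 ->
  (forall C, C_feasible M Omega C ->
     h C1 + imag_inner delta C1 <= h C + imag_inner delta C) ->
  8^-1 * tfrob (C1 - C0) ^+ 2 <= h C0 - h C1.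
Proof.
move=> h l1 l2 /tfrob_tproj_setC -> delta_le feas0 feas1 min1.
have delta_sq : tfrob delta ^+ 2 <= 16^-1 * tfrob (C1 - C0) ^+ 2.
  have := delta_le; move: (tfrob (C1 - C0)) => d.
  have : 0 <= tfrob delta by exact: sqrtr_ge0.
  by move: (tfrob delta) => e; nra.
have [Z ZE] := tcomb_exists 4^-1 C0 C1.
have := min1 Z (C_feasible_comb ZE feas0 feas1); rewrite /h {h min1}.
have diffE l i j : (C1 - C0) l i j = (P - C0) l i j - (P - C1) l i j.
  apply: (eq_trans (tensorBE C1 C0 l i j)).
  pose diff (x y : quat R) := x - y.
  apply: (eq_trans _ (esym (congr2 diff (tensorBE P C0 l i j)
    (tensorBE P C1 l i j)))).
  by apply: quat_ext => /=; ring.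
have := tfrob_sq_comb (is_tcomb_sub P ZE) diffE.
have quarter : 0 <= (4^-1 : R) <= 1 by apply/andP; split; lra.
have := TV_comb_le l1 l2 quarter ZE.
have := imag_inner_comb delta ZE.
have := imag_inner_sub_le delta (tensorBE C1 C0).
move: delta_sq.
move: (tfrob (C1 - C0)) (tfrob delta) => d e.
move: (tfrob (P - Z)) (tfrob (P - C0)) (tfrob (P - C1)) => pz p0 p1.
move: (d ^+ 2) (e ^+ 2) (pz ^+ 2) (p0 ^+ 2) (p1 ^+ 2) => {}d {}e {}pz {}p0 {}p1.
move: (TV _ _ Z) (TV _ _ C0) (TV _ _ C1) => tz t0 t1.
move: (imag_inner _ Z) (imag_inner _ C0) (imag_inner _ C1) => iz i0 i1.
by lra.
Qed.

End PerturbedMinimum.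

(** * Coordinates *)

Lemma sum_pair (V : nmodType) (I J : finType) (F : I * J -> V) :
  \sum_p F p = \sum_i \sum_j F (i, j).
Proof. by rewrite pair_bigA; apply: eq_bigr => -[]. Qed.

Lemma sum_tagged (V : nmodType) (I : finType) (J : I -> finType)
    (F : {i : I & J i} -> V) :
  \sum_p F p = \sum_i \sum_(x : J i) F (Tagged J x).
Proof.
rewrite (sig_big_dep _ (fun _ _ => true) (fun i x => F (Tagged J x))) /=.
by apply: eq_bigr => -[].
Qed.

Section Coordinates.
Context {R : realType} {n1 n2 n3 : nat} {r : 'I_n3 -> nat}.
Local Notation vars := {ffun zcoord n1 n2 r -> R}.
Implicit Types z : vars.

Lemma norm2_sq z :
  norm2 z ^+ 2 = tfrob (Cof z) ^+ 2 + \sum_l mfrob (Aof z l) ^+ 2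
                 + \sum_l mfrob (Bof z l) ^+ 2.
Proof.
rewrite sqr_sqrtr ?sumr_ge0 // => [|a _]; last exact: sqr_ge0.
rewrite big_sumType big_sumType /= addrA; congr (_ + _ + _).
- rewrite tfrob_sqE !sum_pair [RHS]exchange_big; apply: eq_bigr => i _ /=.
  rewrite [RHS]exchange_big; apply: eq_bigr => j _; apply: eq_bigr => l _ /=.
  rewrite ffunE mxE /qnormsq /= expr0n add0r 3!big_ord_recl big_ord0 addr0 addrA.
  by congr (z _ ^+ 2 + z _ ^+ 2 + z _ ^+ 2); congr inl; congr pair; apply: val_inj.
- rewrite sum_tagged; apply: eq_bigr => l _; rewrite mfrob_sq !sum_pair.
  apply: eq_bigr => i _; apply: eq_bigr => p _.
  rewrite mxE /qnormsq /= 4!big_ord_recl big_ord0 addr0 !addrA.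
  by congr (z _ ^+ 2 + z _ ^+ 2 + z _ ^+ 2 + z _ ^+ 2); congr (inr (inl _));
    congr existT; congr pair; apply: val_inj.
- rewrite sum_tagged; apply: eq_bigr => l _; rewrite mfrob_sq !sum_pair.
  apply: eq_bigr => p _; apply: eq_bigr => j _.
  rewrite mxE /qnormsq /= 4!big_ord_recl big_ord0 addr0 !addrA.
  by congr (z _ ^+ 2 + z _ ^+ 2 + z _ ^+ 2 + z _ ^+ 2); congr (inr (inr _));
    congr existT; congr pair; apply: val_inj.
Qed.

Lemma norm2_subC z z' : norm2 (z - z') = norm2 (z' - z).
Proof.
congr Num.sqrt; apply: eq_bigr => a _.
by rewrite !ffunE -sqrrN opprB.
Qed.

Lemma CofE z l i j :
  Cof z l i j = Quat 0 (z (inl (i, j, l, 0))) (z (inl (i, j, l, 1)))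
                       (z (inl (i, j, l, 2))).
Proof. by rewrite ffunE mxE. Qed.

Lemma CofB z z' l i j : Cof (z - z') l i j = (Cof z - Cof z') l i j.
Proof.
apply: (eq_trans _ (esym (tensorBE (Cof z) (Cof z') l i j))).
by rewrite !CofE; apply: quat_ext; rewrite /= ?subr0 ?ffunE.
Qed.

Lemma AofB z z' l : Aof (z - z') l = Aof z l - Aof z' l.
Proof.
by apply/matrixP => i j; rewrite !mxE; apply: quat_ext; rewrite /= !ffunE.
Qed.

Lemma BofB z z' l : Bof (z - z') l = Bof z l - Bof z' l.
Proof.
by apply/matrixP => i j; rewrite !mxE; apply: quat_ext; rewrite /= !ffunE.
Qed.

Lemma norm2_sub_sq z z' :
  norm2 (z - z') ^+ 2 = tfrob (Cof z' - Cof z) ^+ 2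
    + \sum_l mfrob (Aof z l - Aof z' l) ^+ 2
    + \sum_l mfrob (Bof z l - Bof z' l) ^+ 2.
Proof.
rewrite norm2_subC norm2_sq -(tensor_ext (CofB z' z)).
congr (_ + _ + _); apply: eq_bigr => l _.
  by rewrite AofB -mfrob_sqN opprB.
by rewrite BofB -mfrob_sqN opprB.
Qed.

End Coordinates.

(** * Descent and boundedness *)

Section Descent.
Context {R : realType} {n1 n2 n3 : nat} {r : 'I_n3 -> nat}.
Variables (mu : quat R) (M : tensor (quat R) n1 n2 n3).
Variables (Omega : {set 'I_n1 * 'I_n2 * 'I_n3}).
Variables (lambda lambda1 lambda2 beta : R).
Hypotheses (n3_gt0 : (0 < n3)%N) (mu_unit : unit_pure mu).
Hypotheses (lambda_gt0 : 0 < lambda) (lambda1_gt0 : 0 < lambda1).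
Hypotheses (lambda2_gt0 : 0 < lambda2) (beta_gt0 : 0 < beta).
Local Notation vars := {ffun zcoord n1 n2 r -> R}.
Local Notation f := (objective mu lambda lambda1 lambda2).
Implicit Types z : vars.

Definition fourier_residual (C : tensor (quat R) n1 n2 n3)
    (A : forall l, 'M[quat R]_(n1, r l)) (B : forall l, 'M[quat R]_(r l, n2)) :=
  \sum_l mfrob (A l *m B l - qdft mu C l) ^+ 2.

Definition ffrobsq (m n : 'I_n3 -> nat) (A : forall l, 'M[quat R]_(m l, n l)) : R :=
  \sum_l mfrob (A l) ^+ 2.

Lemma ffrobsq_ge0 (m n : 'I_n3 -> nat) (A : forall l, 'M[quat R]_(m l, n l)) :
  0 <= ffrobsq A.
Proof. by apply: sumr_ge0 => l _; exact: sqr_ge0. Qed.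

Lemma ffrob_sq (m n : 'I_n3 -> nat) (A : forall l, 'M[quat R]_(m l, n l)) :
  ffrob A ^+ 2 = ffrobsq A.
Proof. by rewrite sqr_sqrtr // ffrobsq_ge0. Qed.

Lemma data_termE C (A : forall l, 'M[quat R]_(n1, r l)) B :
  tfrob (qprod mu A B - C) ^+ 2 = n3%:R^-1 * fourier_residual C A B.
Proof.
rewrite /fourier_residual -(qprod_parseval mu_unit A B C n3_gt0).
by rewrite mulKf // pnatr_eq0 -lt0n.
Qed.

Lemma objectiveE z :
  f z = 2^-1 * (n3%:R^-1 * fourier_residual (Cof z) (Aof z) (Bof z))
        + lambda / (2 * n3%:R) * (ffrobsq (Aof z) + ffrobsq (Bof z))
        + TV lambda1 lambda2 (Cof z).
Proof.
pose g x a b := 2^-1 * x + lambda / (2 * n3%:R) * (a + b)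
                + TV lambda1 lambda2 (Cof z).
exact: (f_equal3 g (data_termE (Cof z) (Aof z) (Bof z))
  (ffrob_sq (Aof z)) (ffrob_sq (Bof z))).
Qed.

Lemma sum_decrease (I : finType) (c k : R) (d x a y b : I -> R) :
  (forall l, c * d l <= x l + k * a l - (y l + k * b l)) ->
  c * \sum_l d l
  <= \sum_l x l + k * \sum_l a l - (\sum_l y l + k * \sum_l b l).
Proof.
by move=> le_d; rewrite !mulr_sumr -!big_split -sumrB; exact: ler_sum.
Qed.

Lemma A_step_decrease z z' :
  A_step mu lambda beta z z' ->
  (2 * beta + lambda) * \sum_l mfrob (Aof z l - Aof z' l) ^+ 2
  <= fourier_residual (Cof z') (Aof z) (Bof z) + lambda * ffrobsq (Aof z)
     - (fourier_residual (Cof z') (Aof z') (Bof z)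
        + lambda * ffrobsq (Aof z')).
Proof.
move=> stepA; apply: sum_decrease => l.
exact: (ridge_left_decrease lambda_gt0 beta_gt0 (stepA l)).
Qed.

Lemma B_step_decrease z z' :
  B_step mu lambda beta z z' ->
  (2 * beta + lambda) * \sum_l mfrob (Bof z l - Bof z' l) ^+ 2
  <= fourier_residual (Cof z') (Aof z') (Bof z) + lambda * ffrobsq (Bof z)
     - (fourier_residual (Cof z') (Aof z') (Bof z')
        + lambda * ffrobsq (Bof z')).
Proof.
move=> stepB; apply: sum_decrease => l.
exact: (ridge_right_decrease lambda_gt0 beta_gt0 (stepB l)).
Qed.

(** The smaller of the constants of the three block updates; the division by
    [2 * n3] converts squared norms of transforms back to the objective. *)
Definition descent_constant : R :=
  Num.min 8^-1 (2^-1 * n3%:R^-1 * (2 * beta + lambda)).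

Lemma descent_constant_gt0 : 0 < descent_constant.
Proof.
by rewrite lt_min !mulr_gt0 ?addr_gt0 ?mulr_gt0 ?invr_gt0 ?ltr0n.
Qed.

Lemma QRTC_step_decrease z z' :
  C_feasible M Omega (Cof z) ->
  C_step mu M Omega lambda1 lambda2 z z' ->
  A_step mu lambda beta z z' -> B_step mu lambda beta z z' ->
  descent_constant * norm2 (z - z') ^+ 2 <= f z - f z'.
Proof.
move=> feas [delta [_ obs0 delta_le feas' min']] stepA stepB.
have := perturbed_min_decrease (ltW lambda1_gt0) (ltW lambda2_gt0) obs0 delta_le
  feas feas' min'.
have := A_step_decrease stepA; have := B_step_decrease stepB.
move: (data_termE (Cof z) (Aof z) (Bof z)) (data_termE (Cof z') (Aof z) (Bof z)).
rewrite norm2_sub_sq !objectiveE.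
move: (tfrob (qprod mu (Aof z) (Bof z) - Cof z)) => x.
move: (tfrob (qprod mu (Aof z) (Bof z) - Cof z')) => y -> ->.
have -> : lambda / (2 * n3%:R) = 2^-1 * n3%:R^-1 * lambda.
  by rewrite invfM mulrC.
have : descent_constant <= 8^-1 by rewrite ge_min lexx.
have : descent_constant <= 2^-1 * n3%:R^-1 * (2 * beta + lambda).
  by rewrite ge_min lexx orbT.
have w_gt0 : 0 < n3%:R^-1 :> R by rewrite invr_gt0 ltr0n.
move: (descent_constant) (n3%:R^-1) w_gt0 => K w w_gt0.
have C_ge0 := sqr_ge0 (tfrob (Cof z' - Cof z)).
have A_ge0 : 0 <= \sum_l mfrob (Aof z l - Aof z' l) ^+ 2.
  by apply: sumr_ge0 => l _; exact: sqr_ge0.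
have B_ge0 : 0 <= \sum_l mfrob (Bof z l - Bof z' l) ^+ 2.
  by apply: sumr_ge0 => l _; exact: sqr_ge0.
move: C_ge0 A_ge0 B_ge0.
move: (\sum_l mfrob (Aof z l - Aof z' l) ^+ 2) => dA.
move: (\sum_l mfrob (Bof z l - Bof z' l) ^+ 2) => dB.
move: (tfrob (Cof z' - Cof z)) => d; move: (d ^+ 2) => {d} dC dC0 dA0 dB0.
move: (fourier_residual (Cof z') (Aof z') (Bof z')) => res111.
move: (fourier_residual (Cof z') (Aof z') (Bof z)) => res110.
move: (fourier_residual (Cof z') (Aof z) (Bof z)) => res100.
move: (fourier_residual (Cof z) (Aof z) (Bof z)) => res000.
move: (ffrobsq (Aof z)) (ffrobsq (Aof z')) => a a'.
move: (ffrobsq (Bof z)) (ffrobsq (Bof z')) => b b'.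
move: (TV _ _ (Cof z)) (TV _ _ (Cof z')) => t t' K_fac K_C decB decA decC.
have := ler_wpM2r dC0 K_C; have := ler_wpM2r dA0 K_fac.
have := ler_wpM2r dB0 K_fac.
have := ler_wpM2l (ltW w_gt0) decA; have := ler_wpM2l (ltW w_gt0) decB.
by lra.
Qed.

Lemma objective_parts_ge0 z :
  [/\ 0 <= fourier_residual (Cof z) (Aof z) (Bof z),
      0 <= ffrobsq (Aof z), 0 <= ffrobsq (Bof z)
    & 0 <= TV lambda1 lambda2 (Cof z)].
Proof.
split; [|exact: ffrobsq_ge0|exact: ffrobsq_ge0|].
  by apply: sumr_ge0 => l _; exact: sqr_ge0.
by apply: addr_ge0; (apply: mulr_ge0; first exact: ltW);
  apply: sumr_ge0 => k _; exact: sqr_ge0.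
Qed.

Lemma qdft_sq_le C (A : forall l, 'M[quat R]_(n1, r l)) B :
  n3%:R * tfrob C ^+ 2
  <= 2 * fourier_residual C A B + 2 * (ffrobsq A * ffrobsq B).
Proof.
rewrite -(qdft_parseval mu_unit).
apply: (@le_trans _ _ (\sum_l (2 * mfrob (A l *m B l - qdft mu C l) ^+ 2
    + 2 * (mfrob (A l) ^+ 2 * mfrob (B l) ^+ 2)))).
  apply: ler_sum => l _; apply: (le_trans (mfrob_sq_le_sub (A l *m B l) _)).
  by rewrite lerD2l ler_pM2l // mfrob_sqM_le.
rewrite big_split -!mulr_sumr lerD2l ler_pM2l //= /ffrobsq mulr_suml.
apply: ler_sum => l _; rewrite ler_wpM2l ?sqr_ge0 // (bigD1 l) //= lerDl.
by apply: sumr_ge0 => k _; exact: sqr_ge0.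
Qed.

(** The objective is coercive: its value controls the factors through the
    regularization, hence their product, and then [Cof z] through the data
    term. *)
Lemma norm2_sq_le z (a : R) :
  f z <= a ->
  norm2 z ^+ 2 <= n3%:R^-1 * (2 * (2 * n3%:R * a)
                              + 2 * (2 * n3%:R * a / lambda) ^+ 2)
                  + 2 * n3%:R * a / lambda.
Proof.
have [res0 a0 b0 tv0] := objective_parts_ge0 z.
rewrite norm2_sq objectiveE -/(ffrobsq (Aof z)) -/(ffrobsq (Bof z)) => f_le.
have := qdft_sq_le (Cof z) (Aof z) (Bof z).
have n_gt0 : 0 < n3%:R :> R by rewrite ltr0n.
move: (tfrob (Cof z)) => d; move: (d ^+ 2) => {d} d.
move: (fourier_residual _ _ _) (TV _ _ _) (ffrobsq (Aof z))
  (ffrobsq (Bof z)) (n3%:R : R) n_gt0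
  f_le res0 a0 b0 tv0 => x t u v n n_gt0 f_le x0 u0 v0 t0 d_le.
have n_ge0 := ltW n_gt0; have lambda_ge0 := ltW lambda_gt0.
have x_le : x <= 2 * n * a.
  have : 0 <= lambda / (2 * n) * (u + v).
    by rewrite mulr_ge0 ?addr_ge0 ?divr_ge0 ?mulr_ge0.
  have : x = 2 * n * (2^-1 * (n^-1 * x)) by field; rewrite gt_eqF.
  by move=> {1}-> reg_ge0; rewrite ler_pM2l ?mulr_gt0 //; lra.
have uv_le : u + v <= 2 * n * a / lambda.
  rewrite ler_pdivlMr //.
  have : (u + v) * lambda = 2 * n * (lambda / (2 * n) * (u + v)).
    by field; rewrite gt_eqF.
  have : 0 <= 2^-1 * (n^-1 * x) by rewrite !mulr_ge0 ?invr_ge0.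
  by move=> data_ge0 ->; rewrite ler_pM2l ?mulr_gt0 //; lra.
rewrite -addrA lerD // ler_pdivlMl //.
apply: le_trans d_le _; rewrite lerD ?ler_pM2l //.
move: (2 * n * a / lambda) uv_le => c uv_le.
by rewrite expr2 ler_pM //; lra.
Qed.

End Descent.

Theorem theorem4p2 (R : realType) (n1 n2 n3 : nat) (r : 'I_n3 -> nat)
    (hn1 : (0 < n1)%N) (hn2 : (0 < n2)%N) (hn3 : (0 < n3)%N)
    (hr : forall l, (0 < r l)%N)
    (mu : quat R) (hmu : unit_pure mu)
    (M : tensor (quat R) n1 n2 n3) (hM : tpart (@qre R) M = 0)
    (Omega : {set 'I_n1 * 'I_n2 * 'I_n3})
    (lambda lambda1 lambda2 beta : R)
    (hlambda : 0 < lambda) (hlambda1 : 0 < lambda1) (hlambda2 : 0 < lambda2)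
    (hbeta : 0 < beta)
    (z : nat -> {ffun zcoord n1 n2 r -> R})
    (hz : QRTC mu M Omega lambda lambda1 lambda2 beta z) :
  (exists K1 : R, 0 < K1 /\
     forall t : nat,
       objective mu lambda lambda1 lambda2 (z t)
         - objective mu lambda lambda1 lambda2 (z t.+1)
       >= K1 * norm2 (z t - z t.+1) ^+ 2)
  /\ (exists b : R, forall t : nat, norm2 (z t) <= b).
Proof.
case: hz => feas0 steps; pose K := @descent_constant R n3 lambda beta.
have feas t : C_feasible M Omega (Cof (z t)).
  case: t => [|t]; last by case: (steps t) => -[delta []].
  by split=> //; apply/tpart_eq0 => l i j; rewrite CofE.
have descent t : K * norm2 (z t - z t.+1) ^+ 2
    <= objective mu lambda lambda1 lambda2 (z t)
       - objective mu lambda lambda1 lambda2 (z t.+1).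
  case: (steps t) => stepC stepA stepB.
  exact: (QRTC_step_decrease hn3 hmu hlambda hlambda1 hlambda2 hbeta (feas t)
    stepC stepA stepB).
have K_gt0 : 0 < K := descent_constant_gt0 hn3 hlambda hbeta.
split; first by exists (K); split.
pose f0 := objective mu lambda lambda1 lambda2 (z 0%N).
have f_le t : objective mu lambda lambda1 lambda2 (z t) <= f0.
  elim: t => [|t IHt]; first exact: lexx.
  apply: le_trans IHt; rewrite -subr_ge0; apply: le_trans (descent t).
  by rewrite mulr_ge0 ?sqr_ge0 ?ltW.
have norm2_le := fun t => norm2_sq_le hn3 hmu hlambda hlambda1 hlambda2 (f_le t).
eexists => t; apply: le_trans (ler_wsqrtr (norm2_le t)).
by rewrite sqrtr_sqr ler_norm.
Qed.
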